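(* Let $M\ge1$ and consider rapidities $(\mu_m,x_m)$ and inhomogeneities $(\xi_m,z_m)$, $1\le m\le M$, complex with nonzero entries and generic in the sense specified in the context. Then the domain wall partition function of type $B$, $$Z^{(B)}_M=\langle1|\,B_{1\dots M}(\mu_1,x_1)\cdots B_{1\dots M}(\mu_M,x_M)\,|0\rangle,$$ equals $$Z^{(B)}_M=\left(\frac{z_1}{x_1}\right)^{\frac{2M-1}2}\left(\frac{z_2}{x_2}\right)^{\frac{2M-3}2}\cdots\left(\frac{z_M}{x_M}\right)^{\frac12}\ \frac{\prod_{k=1}^M\sqrt{\mu_k\xi_k}\ \prod_{m,n=1}^M(\mu_m-\xi_n)}{\prod_{1\le p<q\le M}(\mu_p-\mu_q)(\xi_q-\xi_p)}\ \det\left[\frac{\rho-1}{(\mu_i\rho-\xi_j)(\mu_i-\xi_j)}\right]_{i,j=1,\dots,M}.$$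
   Context: Fix $\rho\in\mathbb C\setminus\{0,1\}$. Spectral parameters are pairs $\lambda=(\mu,x)$; for $\lambda=(\mu,x)$, $\lambda'=(\xi,z)$ the $R$-matrix is, in the ordered basis $(e_1\otimes e_1,e_1\otimes e_2,e_2\otimes e_1,e_2\otimes e_2)$ of $\mathbb C^2\otimes\mathbb C^2$, $$R(\lambda,\lambda')=\begin{pmatrix}1&0&0&0\\0&\frac{\sqrt\rho}{x}\frac{\mu-\xi}{\mu\rho-\xi}&(\rho-1)\sqrt{\frac zx}\frac{\sqrt{\mu\xi}}{\mu\rho-\xi}&0\\0&(\rho-1)\sqrt{\frac zx}\frac{\sqrt{\mu\xi}}{\mu\rho-\xi}&\sqrt\rho\,z\frac{\mu-\xi}{\mu\rho-\xi}&0\\0&0&0&\frac zx\end{pmatrix}.$$ Square roots of $\rho$ and of each $\mu_m,\xi_m,x_m,z_m$ are fixed once and for all; $\sqrt{z/x}=\sqrt z/\sqrt x$, $\sqrt{\mu\xi}=\sqrt\mu\sqrt\xi$, and half-integer powers mean the corresponding powers of these fixed roots. $R_{ai}$ acts as $R$ on $V_a\otimes V_i$ (first factor $V_a$), $V_a,V_i\cong\mathbb C^2$. The monodromy matrix is $R_{aM}((\mu,x),(\xi_M,z_M))\cdots R_{a1}((\mu,x),(\xi_1,z_1))=\begin{pmatrix}A_{1\dots M}(\mu,x)&B_{1\dots M}(\mu,x)\\C_{1\dots M}(\mu,x)&D_{1\dots M}(\mu,x)\end{pmatrix}_a$, a $2\times 2$ matrix in $V_a$. $|0\rangle=\bigotimes_{i=1}^Me_1$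 and $\langle1|$ is the transpose of $\bigotimes_{i=1}^Me_2$. Genericity: the $\mu_m$ are pairwise distinct, the $\xi_m$ are pairwise distinct, $\mu_i\neq\xi_j$, $\mu_i\rho\ne\xi_j$ for all $i,j$, and $\xi_i\rho\neq\xi_j$ for $i\ne j$. *)

(* Defs.v *)
From HB Require Import structures.
From mathcomp Require Import all_boot all_order all_algebra.
From mathcomp Require Import reals complex mxtens.

Set Implicit Arguments.
Unset Strict Implicit.
Unset Printing Implicit Defensive.

Import GRing.Theory.
Local Open Scope ring_scope.

(* A spectral parameter (mu, x) bundled with the chosen values of sqrt mu and
   sqrt x; that these really are square roots is left to the users of the
   record, so that the definitions below make sense for arbitrary data. *)
Record spectral (F : Type) := Spectral {
  sp_mu : F; sp_x : F; sp_sqrt_mu : F; sp_sqrt_x : F }.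

Section TensorPower.
Variables (F : fieldType) (S : finType).

(* The tensor product of copies of F^2 indexed by S has as basis the vectors
   e_c, the tensor product over k in S of e_(c k), where c : S -> {0, 1} and
   0, 1 : 'I_2 stand for the indices of e_1, e_2.  Operators are matrices
   acting on column vectors: the row index is the output configuration. *)
Definition config := {ffun S -> 'I_2}.
Definition tensop := 'M[F]_#|config|.

Definition basis_vec (c : config) : 'cV[F]_#|config| :=
  delta_mx (enum_rank c) 0.

(* The 4 x 4 matrix A acts on the factors a (first) and i (second), with
   a != i.  The bijection mxtens_index (p, q) = 2 p + q is the order
   e_1 e_1, e_1 e_2, e_2 e_1, e_2 e_2. *)
Definition two_site (a i : S) (A : 'M[F]_(2 * 2)) : tensop :=
  \matrix_(r, s)
    let c := enum_val r : config in
    let d := enum_val s : config in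
    A (mxtens_index (c a, c i)) (mxtens_index (d a, d i))
      *+ [forall k, (k != a) && (k != i) ==> (c k == d k)].

End TensorPower.

Section PartitionFunction.
Variables (F : fieldType) (rho sqrt_rho : F).

Definition Rmatrix (l l' : spectral F) : 'M[F]_(2 * 2) :=
  let: Spectral mu x smu sx := l in
  let: Spectral xi z sxi sz := l' in
  let b := sqrt_rho / x * ((mu - xi) / (mu * rho - xi)) in
  let c := (rho - 1) * (sz / sx) * (smu * sxi / (mu * rho - xi)) in
  let b' := sqrt_rho * z * ((mu - xi) / (mu * rho - xi)) in
  \matrix_(i, j) nth 0 (nth [::]
    [:: [:: 1; 0; 0; 0];
        [:: 0; b; c; 0];
        [:: 0; c; b'; 0];
        [:: 0; 0; 0; z / x]] i) j.

Variables (M : nat) (inhom : 'I_M -> spectral F).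

(* The factors of V_a (x) V_1 (x) ... (x) V_M are indexed by option 'I_M:
   None is the auxiliary space V_a and Some i is the i-th quantum space,
   i ranging from 0 to M - 1. *)

(* R_{aM} ... R_{a1}: the factor with the largest index is leftmost. *)
Definition monodromy (l : spectral F) : tensop F (option 'I_M) :=
  \prod_(i <- rev (enum 'I_M))
    two_site None (Some i) (Rmatrix l (inhom i)).

Definition aux_config (p : 'I_2) (c : config 'I_M) : config (option 'I_M) :=
  [ffun k => if k is Some i then c i else p].

(* The (p, q) entry of an operator on V_a (x) V_1 (x) ... (x) V_M viewed as a
   2 x 2 matrix in V_a. *)
Definition aux_block (T : tensop F (option 'I_M)) (p q : 'I_2) :
    tensop F 'I_M :=
  \matrix_(r, s) T (enum_rank (aux_config p (enum_val r)))
                   (enum_rank (aux_config q (enum_val s))).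

Definition opB (l : spectral F) : tensop F 'I_M := aux_block (monodromy l) 0 1.

Definition ket0 : 'cV[F]_#|config 'I_M| := basis_vec F [ffun _ => 0].
Definition bra1 : 'rV[F]_#|config 'I_M| := (basis_vec F [ffun _ => 1])^T.

(* <1| B(l_1) ... B(l_M) |0>; the matrix product is taken in increasing
   order of the index, B(l_1) being leftmost. *)
Definition ZB (rapid : 'I_M -> spectral F) : F :=
  (bra1 *m (\prod_(m < M) opB (rapid m)) *m ket0) 0 0.

End PartitionFunction.

(* Main.v *)
Require Import Defs.
From HB Require Import structures.
From mathcomp Require Import all_boot all_order all_algebra.
From mathcomp Require Import reals complex mxtens.
From mathcomp Require Import ring zify boolp.

Set Implicit Arguments.
Unset Strict Implicit.
Unset Printing Implicit Defensive.

Import GRing.Theory Num.Theory.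
Local Open Scope ring_scope.

(* The variables x, z and all square roots are pure gauge: a vertex with
   incoming (a, s) and outgoing (a', s') carries them as
   x^-((s'+s)/2) z^((a'+a)/2) mu^((a-a')/2) xi^((s'-s)/2), which telescopes along
   rows and columns.  After division by mu rho - xi, there remains a partition
   function with weights polynomial in mu and xi, and one follows Izergin and
   Korepin.  The rows commute by the Yang-Baxter equation, so any rapidity mu_i
   can be moved to the row acting first; at xi_1 = mu_i that row and the first
   column freeze, which gives the partition function of size M - 1.  As a function
   of xi_1 the partition function is polynomial of degree < M.  Multiplied by
   prod_q (xi_q - xi_1), both sides of the determinant formula are polynomials in
   xi_1 of degree at most 2 M - 2, and they agree at the 2 M - 1 points mu_i and
   xi_2, ..., xi_M. *)

(** * Spin configurations on N sites, with the first site split off *)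

Lemma ord2P (P : 'I_2 -> Prop) : P 0 -> P 1 -> forall i, P i.
Proof.
move=> P0 P1 [[|[|//]] lti].
  by rewrite (_ : Ordinal lti = 0) //; apply: val_inj.
by rewrite (_ : Ordinal lti = 1) //; apply: val_inj.
Qed.

Lemma big_ord2 (V : nmodType) (f : 'I_2 -> V) : \sum_i f i = f 0 + f 1.
Proof. by rewrite !big_ord_recl big_ord0 addr0; congr (_ + f _); apply: val_inj. Qed.

(** With families stored as functions on ['I_N], [ocons t xi] turns the first inhomogeneity into a
    variable t while the others stay fixed. *)
Definition ocons T N (s : T) (t : 'I_N -> T) (i : 'I_N.+1) : T :=
  oapp t s (unlift ord0 i).

Lemma ocons0 T N (s : T) (t : 'I_N -> T) : ocons s t ord0 = s.
Proof. by rewrite /ocons unlift_none. Qed.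

Lemma oconsS T N (s : T) (t : 'I_N -> T) j : ocons s t (lift ord0 j) = t j.
Proof. by rewrite /ocons liftK. Qed.

Lemma ocons_eta T N (f : 'I_N.+1 -> T) : ocons (f ord0) (f \o lift ord0) = f.
Proof. by apply/funext => i; rewrite /ocons; case: unliftP => [j ->|->]. Qed.

Definition ccons N (s : 'I_2) (t : config 'I_N) : config 'I_N.+1 :=
  [ffun i => ocons s t i].

Lemma ccons0 N s (t : config 'I_N) : ccons s t ord0 = s.
Proof. by rewrite ffunE ocons0. Qed.

Lemma cconsS N s (t : config 'I_N) j : ccons s t (lift ord0 j) = t j.
Proof. by rewrite ffunE oconsS. Qed.

Definition ctail N (c : config 'I_N.+1) : config 'I_N := [ffun j => c (lift ord0 j)].

Lemma ccons_eta N (c : config 'I_N.+1) : ccons (c ord0) (ctail c) = c.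
Proof.
apply/ffunP => i; rewrite ffunE /ocons; case: unliftP => [j ->|->] //=.
by rewrite ffunE.
Qed.

Lemma ctailK N s (t : config 'I_N) : ctail (ccons s t) = t.
Proof. by apply/ffunP => j; rewrite ffunE cconsS. Qed.

Lemma sum_ccons (V : nmodType) N (f : config 'I_N.+1 -> V) :
  \sum_c f c = \sum_s \sum_t f (ccons s t).
Proof.
rewrite pair_big /= (reindex (fun p => ccons p.1 p.2)) //=.
exists (fun c : config 'I_N.+1 => (c ord0, ctail c)) => [[s t] _|c _] /=.
  by rewrite ccons0 ctailK.
exact: ccons_eta.
Qed.

Lemma config0 (c d : config 'I_0) : c = d.
Proof. by apply/ffunP => -[]. Qed.

Lemma sum_config0 (V : nmodType) (f : config 'I_0 -> V) (c : config 'I_0) :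
  \sum_d f d = f c.
Proof. by rewrite (big_pred1 c) // => d; rewrite /= (config0 d c) eqxx. Qed.

(** * Rows of the lattice as ordered products of 2 x 2 matrices *)

Section Row.
Variable F : fieldType.

(** An operator on the auxiliary space, between fixed output [c] and input [d] of the quantum sites.
    Site 0 is rightmost, so inductions on N split it off on the right. *)
Definition site_prod N (V : 'I_N -> 'I_2 -> 'I_2 -> 'M[F]_2) (c d : 'I_N -> 'I_2) :
    'M[F]_2 :=
  \prod_(i <- rev (enum 'I_N)) V i (c i) (d i).

Lemma site_prod0 (V : 'I_0 -> 'I_2 -> 'I_2 -> 'M[F]_2) c d : site_prod V c d = 1.
Proof. by rewrite /site_prod (size0nil (size_enum_ord 0)) big_nil. Qed.

Lemma site_prodS N (V : 'I_N.+1 -> 'I_2 -> 'I_2 -> 'M[F]_2) (c d : config 'I_N.+1) :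
  site_prod V c d =
  site_prod (V \o lift ord0) (ctail c) (ctail d) * V ord0 (c ord0) (d ord0).
Proof.
rewrite /site_prod enum_ordSl rev_cons -map_rev big_rcons /= big_map; congr (_ * _).
by apply: eq_bigr => i _; rewrite !ffunE.
Qed.

Definition apply_kernel N (K : config 'I_N -> config 'I_N -> F)
    (v : {ffun config 'I_N -> F}) : {ffun config 'I_N -> F} :=
  [ffun c => \sum_d K c d * v d].

Definition vacuum N : {ffun config 'I_N -> F} :=
  [ffun c => (c == [ffun=> 0])%:R].

End Row.

Lemma sum_mxtens (V : nmodType) m n (f : 'I_(m * n) -> V) :
  \sum_k f k = \sum_i \sum_j f (mxtens_index (i, j)).
Proof.
rewrite pair_big /= (reindex (@mxtens_index m n)) /=.
  by apply: eq_bigr => -[].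
by exists (@mxtens_unindex m n) => k _; rewrite (mxtens_indexK, mxtens_unindexK).
Qed.

(** * Polynomial vertex weights and the matrix intertwining two rows *)

Section Weights.
Variables (F : fieldType) (rho r : F).

(* The R-matrix times mu rho - xi, without the gauge factors: the two equal
   off-diagonal entries c become rho - 1 (auxiliary spin e_2 -> e_1) and
   (rho - 1) mu xi (e_1 -> e_2), so that all entries are polynomial. *)
Definition weight (mu xi : F) (s' s : 'I_2) : 'M[F]_2 :=
  \matrix_(a', a)
    if (a' + s' != a + s)%N then 0
    else if a' == a then (if a == s then mu * rho - xi else r * (mu - xi))
    else if a == 1 then rho - 1 else (rho - 1) * (mu * xi).

Definition Brow N (xi : 'I_N -> F) (mu : F) (c d : config 'I_N) : F :=
  site_prod (fun i => weight mu (xi i)) c d 0 1.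

Definition bethe N (xi : 'I_N -> F) (mus : seq F) : {ffun config 'I_N -> F} :=
  foldr (fun mu => apply_kernel (Brow xi mu)) (vacuum F N) mus.

(** The R-matrix of two auxiliary spaces in a gauge compatible with [weight]: the off-diagonal
    entries are distributed differently, but have the same product. *)
Definition intertwiner (mu nu : F) : 'M[F]_(2 * 2) :=
  \matrix_(i, j)
    let: (a', b') := mxtens_unindex i in let: (a, b) := mxtens_unindex j in
    if (a' + b' != a + b)%N then 0
    else if a' == a then (if a == b then mu * rho - nu else r * (mu - nu))
    else if a == 1 then (rho - 1) * nu else (rho - 1) * mu.

End Weights.

(** * The Yang-Baxter equation and the commutation of rows *)

Section YangBaxter.
Variables (F : fieldType) (rho r : F).
Hypothesis r2 : r ^+ 2 = rho.
Local Notation weight := (weight rho r).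
Local Notation Brow := (Brow rho r).
Local Notation intertwiner := (intertwiner rho r).

(** The Yang-Baxter equation at one site: 64 polynomial identities, which hold once rho is written
    as r^2. *)
Lemma weight_intertwine mu nu xi s' s :
  intertwiner mu nu *m (\sum_u weight mu xi s' u *t weight nu xi u s) =
  (\sum_u weight mu xi u s *t weight nu xi s' u) *m intertwiner mu nu.
Proof.
rewrite -r2; apply/matrixP => i j.
case: (mxtens_indexP i) => a' b'; case: (mxtens_indexP j) => a b.
rewrite !mxE !sum_mxtens !big_ord2 !mxE !mxtens_indexK /=.
move: a' b' a b s' s; do 6!(apply: ord2P); rewrite /=; ring.
Qed.

(** The intertwiner is carried through the row site by site: the mixed product rule of [*t]
    separates site 0, where the one-site relation applies. *)
Lemma site_prod_intertwine N (xi : 'I_N -> F) mu nu (c d : config 'I_N) :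
  let V mu i := weight mu (xi i) in
  intertwiner mu nu *m
    (\sum_(u : config 'I_N) site_prod (V mu) c u *t site_prod (V nu) u d) =
  (\sum_(u : config 'I_N) site_prod (V mu) u d *t site_prod (V nu) c u) *m
    intertwiner mu nu.
Proof.
move=> V; rewrite {}/V; elim: N xi c d => [|N IH] xi c d.
  rewrite !(sum_config0 _ c) !site_prod0 (_ : 1 *t 1 = 1%:M) ?mulmx1 ?mul1mx //.
  apply/matrixP => i j; case: (mxtens_indexP i) => a' b'.
  case: (mxtens_indexP j) => a b; rewrite tensmxE !mxE.
  by rewrite (can_eq (@mxtens_indexK _ _)) -natrM mulnb.
rewrite !sum_ccons.
under eq_bigr do under eq_bigr do
  rewrite !site_prodS ctailK ccons0 -!mulmxE -!tensmx_mul.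
under [in RHS]eq_bigr do under eq_bigr do
  rewrite !site_prodS ctailK ccons0 -!mulmxE -!tensmx_mul.
under eq_bigr do rewrite -mulmx_suml.
under [in RHS]eq_bigr do rewrite -mulmx_suml.
rewrite -!mulmx_sumr /= mulmxA IH -!mulmxA; congr (_ *m _).
exact: weight_intertwine.
Qed.

Definition commutator_kernel N (xi : 'I_N -> F) mu nu (c d : config 'I_N) : F :=
  \sum_u (Brow xi mu c u * Brow xi nu u d - Brow xi nu c u * Brow xi mu u d).

(** In row e_1 e_1 and column e_2 e_2 of the relation only B entries occur: conservation reduces the
    first row and the last column of the intertwiner to their corner entries, both mu rho - nu. *)
Lemma commutator_kernel_mul N (xi : 'I_N -> F) mu nu (c d : config 'I_N) :
  (mu * rho - nu) * commutator_kernel xi mu nu c d = 0.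
Proof.
have /matrixP/(_ (mxtens_index (0, 0)))/(_ (mxtens_index (1, 1))) :=
  site_prod_intertwine xi mu nu c d.
rewrite !mxE !sum_mxtens !big_ord2 !summxE !mxE !mxtens_indexK /=
  !(mul0r, mulr0, add0r, addr0).
under eq_bigr do rewrite tensmxE; rewrite (mulrC _ (mu * rho - nu)).
under [in RHS]eq_bigr do rewrite tensmxE mulrC.
by move=> E; apply/eqP; rewrite /commutator_kernel sumrB mulrBr subr_eq0; apply/eqP.
Qed.

End YangBaxter.

(** * Functions given by polynomials of bounded size *)

Section PolynomialFunctions.
Variable F : fieldType.

(** The degree is less than n, and n = 0 forces the zero function. Working with functions avoids
    matrices over polynomials. *)
Definition polyfun (n : nat) (f : F -> F) :=
  exists2 p : {poly F}, (size p <= n)%N & forall t, f t = p.[t].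

Lemma eq_polyfun n f g : f =1 g -> polyfun n f -> polyfun n g.
Proof. by move/funext->. Qed.

Lemma polyfun_leq m n f : (m <= n)%N -> polyfun m f -> polyfun n f.
Proof. by move=> le_mn [p sp fE]; exists p => //; apply: leq_trans le_mn. Qed.

Lemma polyfun0 n : polyfun n (fun=> 0).
Proof. by exists 0 => [|t]; rewrite ?size_poly0 ?horner0. Qed.

Lemma polyfunC c : polyfun 1 (fun=> c).
Proof. by exists c%:P => [|t]; rewrite ?size_polyC_leq1 ?hornerC. Qed.

Lemma polyfun_affine a b f : (forall t, f t = a * t + b) -> polyfun 2 f.
Proof.
move=> fE; exists (a *: 'X + b%:P) => [|t]; last by rewrite fE !hornerE.
rewrite (leq_trans (size_polyD _ _)) // geq_max (leq_trans (size_polyC_leq1 _)) //.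
by rewrite (leq_trans (size_scale_leq _ _)) // size_polyX.
Qed.

Lemma polyfunD n f g : polyfun n f -> polyfun n g -> polyfun n (fun t => f t + g t).
Proof.
move=> [p sp fE] [q sq gE]; exists (p + q) => [|t]; last by rewrite hornerD fE gE.
by rewrite (leq_trans (size_polyD _ _)) // geq_max sp.
Qed.

Lemma polyfun_sum n I (s : seq I) (P : pred I) (f : I -> F -> F) :
  (forall i, P i -> polyfun n (f i)) ->
  polyfun n (fun t => \sum_(i <- s | P i) f i t).
Proof.
move=> fP; elim: s => [|i s IH].
  by under eq_fun do rewrite big_nil; apply: polyfun0.
apply: (eq_polyfun (fun t => esym (big_cons _ _ _ _ _ _))).
by case Pi: (P i) => //; apply: polyfunD => //; apply: fP.
Qed.

Lemma polyfunM m n f g :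
  polyfun m f -> polyfun n g -> polyfun (m + n).-1 (fun t => f t * g t).
Proof.
move=> [p sp fE] [q sq gE]; exists (p * q) => [|t]; last by rewrite hornerM fE gE.
by rewrite (leq_trans (size_polyMleq _ _)) //; lia.
Qed.

Lemma polyfun_prod_ord m N (f : 'I_N -> F -> F) :
  (forall i, polyfun m.+1 (f i)) ->
  polyfun (m * N).+1 (fun t => \prod_(i < N) f i t).
Proof.
elim: N f => [|N IH] f fP.
  apply: (eq_polyfun (fun t => esym (big_ord0 _ _ _ _))).
  by apply: polyfun_leq (polyfunC 1).
apply: (eq_polyfun (f := fun t => f ord0 t * \prod_(i < N) f (lift ord0 i) t)).
  by move=> t; rewrite big_ord_recl.
by apply: polyfun_leq (polyfunM (fP ord0) (IH _ _)); [lia|move=> i; apply: fP].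
Qed.

Lemma polyfun_eq n f g (rs : seq F) : polyfun n f -> polyfun n g ->
  uniq rs -> (n <= size rs)%N -> {in rs, f =1 g} -> f =1 g.
Proof.
move=> [p sp fE] [q sq gE] Urs szrs fg t.
suff pq : p = q by rewrite fE gE pq.
apply/eqP; rewrite -subr_eq0; apply/negPn/negP => pq0.
have rts : all (root (p - q)) rs.
  by apply/allP => u /fg; rewrite fE gE rootE hornerD hornerN subr_eq0 => /eqP.
have := max_poly_roots pq0 rts Urs; rewrite ltnNge => /negP[].
rewrite (leq_trans _ szrs) // (leq_trans (size_polyD _ _)) //.
by rewrite size_polyN geq_max sp.
Qed.

End PolynomialFunctions.

Lemma polyfun_mul_affine_eq0 (F : numFieldType) n (f : F -> F) (a b : F) :
  a != 0 -> polyfun n f -> (forall t, (t * a - b) * f t = 0) -> forall t, f t = 0.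
Proof.
(* These n points avoid the zero b / a of the affine factor and are distinct in characteristic 0. *)
move=> a0 fP f0; pose rs : seq F := [seq b / a + i.+1%:R | i <- iota 0 n].
apply: (polyfun_eq (g := fun=> 0) (rs := rs) fP (polyfun0 _ _)).
- rewrite map_inj_uniq ?iota_uniq // => i j /addrI/eqP.
  by rewrite eqr_nat => /eqP[].
- by rewrite size_map size_iota.
move=> _ /mapP[i _ ->]; move/eqP: (f0 (b / a + i.+1%:R)).
rewrite mulf_eq0 mulrDl divfK // [b + _]addrC addrK mulf_eq0 pnatr_eq0.
by rewrite (negPf a0) => /eqP.
Qed.

(** * Commuting rows, the degree in xi_1, and frozen vertices *)

Section Bethe.
Variables (F : numFieldType) (rho r : F).
Local Notation weight := (weight rho r).
Local Notation Brow := (Brow rho r).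
Local Notation bethe := (bethe rho r).

Lemma weight_polyfun_mu xi s' s a' a : polyfun 2 (fun mu => weight mu xi s' s a' a).
Proof.
under eq_fun do rewrite mxE.
case: (_ != _)%N; first exact: polyfun0.
case: (a' == a); [case: (a == s)|case: (a == 1)].
- by apply: (polyfun_affine (a := rho) (b := - xi)) => t; ring.
- by apply: (polyfun_affine (a := r) (b := - (r * xi))) => t; ring.
- exact: polyfun_leq (polyfunC _).
- by apply: (polyfun_affine (a := (rho - 1) * xi) (b := 0)) => t; ring.
Qed.

Lemma site_prod_polyfun_mu N (xi : 'I_N -> F) (c d : config 'I_N) a' a :
  polyfun N.+1 (fun mu => site_prod (fun i => weight mu (xi i)) c d a' a).
Proof.
elim: N xi c d a' a => [|N IH] xi c d a' a.
  by under eq_fun do rewrite site_prod0; apply: polyfunC.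
under eq_fun do rewrite site_prodS mxE.
apply: polyfun_sum => b _.
by apply: polyfun_leq (polyfunM (IH _ _ _ _ _) (weight_polyfun_mu _ _ _ _ _)); lia.
Qed.

Section Commutation.
Hypotheses (r2 : r ^+ 2 = rho) (rho0 : rho != 0).

(* Commutation is also needed where mu rho = nu, which the genericity
   assumptions allow; the factor mu rho - nu is removed by polynomiality in mu. *)
Lemma commutator_kernel_eq0 N (xi : 'I_N -> F) mu nu c d :
  commutator_kernel rho r xi mu nu c d = 0.
Proof.
apply: (polyfun_mul_affine_eq0 (n := N.+1) (b := nu) rho0
  (f := fun t => commutator_kernel rho r xi t nu c d)); last first.
  by move=> t; apply: commutator_kernel_mul.
apply: polyfun_sum => u _.
have BP c1 c2 : polyfun N.+1 (fun t => Brow xi t c1 c2) by apply: site_prod_polyfun_mu.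
apply: polyfunD.
  by apply: polyfun_leq (polyfunM (BP _ _) (polyfunC (Brow xi nu u d))); lia.
under eq_fun do rewrite -mulNr.
by apply: polyfun_leq (polyfunM (polyfunC (- Brow xi nu c u)) (BP _ _)); lia.
Qed.

Lemma apply_Brow_comm N (xi : 'I_N -> F) mu nu v :
  apply_kernel (Brow xi mu) (apply_kernel (Brow xi nu) v) =
  apply_kernel (Brow xi nu) (apply_kernel (Brow xi mu) v).
Proof.
apply/ffunP => c; rewrite !ffunE.
have E m n : \sum_u Brow xi m c u * apply_kernel (Brow xi n) v u =
             \sum_d (\sum_u Brow xi m c u * Brow xi n u d) * v d.
  under eq_bigr do rewrite ffunE mulr_sumr.
  rewrite exchange_big; apply: eq_bigr => d _; rewrite mulr_suml.
  by apply: eq_bigr => u _; rewrite mulrA.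
rewrite !E; apply: eq_bigr => d _; congr (_ * _); apply/eqP.
by rewrite -subr_eq0 -sumrB; apply/eqP; apply: commutator_kernel_eq0.
Qed.

Lemma bethe_perm N (xi : 'I_N -> F) s1 s2 :
  perm_eq s1 s2 -> bethe xi s1 = bethe xi s2.
Proof.
set act := fun mu => apply_kernel (Brow xi mu).
have comm1 s mu v : foldr act (act mu v) s = act mu (foldr act v s).
  by elim: s => //= nu s ->; apply: apply_Brow_comm.
have comm s t v : foldr act (foldr act v t) s = foldr act (foldr act v s) t.
  by elim: t => //= mu t <-; rewrite comm1.
(* Invariance under permutations reduces to exchanging the two leading blocks of a list. *)
apply/catCA_perm_subst: s1 s2 => t1 t2 t3.
by rewrite /bethe !foldr_cat comm.
Qed.

End Commutation.

(* The loss of one degree when s' = 1 and s = 0 is what brings the degree of the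
   partition function down to M - 1. *)
Lemma weight_polyfun_xi mu (s' s a' a : 'I_2) :
  polyfun (2 + s - s') (fun xi => weight mu xi s' s a' a).
Proof.
under eq_fun do rewrite mxE.
case: eqVneq => /= [e|_]; last exact: polyfun0.
case: eqVneq => [aa|naa]; [case: (a == s)|case: eqVneq => [a1|na1]].
- apply: (@polyfun_leq _ 2); first by move: e; rewrite aa; lia.
  by apply: (polyfun_affine (a := -1) (b := mu * rho)) => t; ring.
- apply: (@polyfun_leq _ 2); first by move: e; rewrite aa; lia.
  by apply: (polyfun_affine (a := - r) (b := r * mu)) => t; ring.
- by apply: polyfun_leq (polyfunC _); move: (ltn_ord s'); lia.
- apply: (@polyfun_leq _ 2).
    by move: e naa na1; move: a' a s' s; do 4!(apply: ord2P).
  by apply: (polyfun_affine (a := (rho - 1) * mu) (b := 0)) => t; ring.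
Qed.

Lemma Brow_cons N xi0 (xi : 'I_N -> F) mu (c d : config 'I_N.+1) :
  Brow (ocons xi0 xi) mu c d =
  \sum_b site_prod (fun i => weight mu (xi i)) (ctail c) (ctail d) 0 b *
         weight mu xi0 (c ord0) (d ord0) b 1.
Proof.
rewrite /Brow site_prodS mxE ocons0; apply: eq_bigr => b _.
by congr (site_prod _ _ _ _ _ * _); apply/funext => i /=; rewrite oconsS.
Qed.

Lemma Brow_polyfun_xi N (xi : 'I_N -> F) mu (c d : config 'I_N.+1) :
  polyfun (2 + d ord0 - c ord0) (fun t => Brow (ocons t xi) mu c d).
Proof.
apply: (eq_polyfun (fun t => esym (Brow_cons t xi mu c d))).
apply: polyfun_sum => b _.
by apply: polyfun_leq (polyfunM (polyfunC _) (weight_polyfun_xi _ _ _ _ _)).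
Qed.

(** The bounds telescope along the first column: each row adds one degree plus input minus output
    spin at site 1, and the vacuum starts with spin 0. *)
Lemma bethe_polyfun N (xi : 'I_N -> F) mus (c : config 'I_N.+1) :
  polyfun ((size mus).+1 - c ord0) (fun t => bethe (ocons t xi) mus c).
Proof.
elim: mus c => [|mu mus IH] c.
  apply: (eq_polyfun (f := fun=> (c == [ffun=> 0])%:R)).
    by move=> t; rewrite ffunE.
  case: eqP => [->|ne]; last exact: polyfun0.
  by rewrite ffunE; apply: polyfunC.
apply: (eq_polyfun (f := fun t =>
  \sum_d Brow (ocons t xi) mu c d * bethe (ocons t xi) mus d)).
  by move=> t; rewrite [RHS]ffunE.
apply: polyfun_sum => d _.
apply: polyfun_leq (polyfunM (Brow_polyfun_xi _ _ _ _) (IH d)).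
(* Spins below 2 keep the truncated subtractions exact. *)
have bound s' s k : (s' < 2 -> s < 2 -> (2 + s - s' + (k.+1 - s)).-1 <= k.+2 - s')%N.
  by lia.
by apply: bound; apply: ltn_ord.
Qed.

Lemma ccons_cst N (s : 'I_2) : ccons s [ffun=> s] = [ffun=> s] :> config 'I_N.+1.
Proof.
by apply/ffunP => i; rewrite !ffunE /ocons; case: unliftP => *; rewrite /= ?ffunE.
Qed.

Lemma ccons_eqE N s t (c d : config 'I_N) :
  (ccons s c == ccons t d) = (s == t) && (c == d).
Proof.
apply/eqP/andP => [E|[/eqP-> /eqP->]//].
by split; apply/eqP; [rewrite -(ccons0 s c) E ccons0|rewrite -(ctailK s c) E ctailK].
Qed.

(** When only e_1 enters the row and e_1 leaves the auxiliary line, conservation allows a single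
    path, which gives the eigenvalue of A on the vacuum. *)
Lemma site_prod_vacuum N (xi : 'I_N -> F) mu (c : config 'I_N) :
  site_prod (fun i => weight mu (xi i)) c ([ffun=> 0] : config 'I_N) 0 0 =
  (c == [ffun=> 0])%:R * \prod_i (mu * rho - xi i).
Proof.
elim: N xi c => [|N IH] xi c.
  by rewrite site_prod0 mxE eqxx big_ord0 mulr1 (config0 c [ffun=> 0]) eqxx.
rewrite site_prodS mxE big_ord2 -{1 2}ccons_cst !ctailK ccons0 IH.
rewrite -[c in LHS]ccons_eta -[c in RHS]ccons_eta -ccons_cst ccons_eqE ctailK ccons0.
rewrite !ccons0 big_ord_recl !mxE; move: (c ord0); apply: ord2P => /=; ring.
Qed.

Lemma bethe_cons N (xi : 'I_N -> F) mu mus c :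
  bethe xi (mu :: mus) c = \sum_d Brow xi mu c d * bethe xi mus d.
Proof. by rewrite [LHS]ffunE. Qed.

(* At xi_1 = mu the weight with a = a' = 1 and s = s' = 0 vanishes, so the row
   acting first must flip site 1; afterwards conservation leaves no choice there. *)
Lemma bethe_frozen N (xi : 'I_N -> F) mu mus s (c : config 'I_N) :
  bethe (ocons mu xi) (rcons mus mu) (ccons s c) =
  (s == 1)%:R * ((rho - 1) * \prod_i (mu * rho - xi i)) *
    (\prod_(m <- mus) (m * rho - mu)) * bethe xi mus c.
Proof.
elim: mus s c => [|m mus IH] s c.
  rewrite big_nil ffunE (bigD1 [ffun=> 0]) //= big1 => [|d /negPf d0]; last first.
    by rewrite ffunE d0 mulr0.
  rewrite !ffunE eqxx addr0 mulr1 -ccons_cst Brow_cons !ctailK !ccons0 big_ord2.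
  rewrite site_prod_vacuum !mxE; move: s; apply: ord2P => /=; ring.
rewrite rcons_cons bethe_cons sum_ccons big_ord2.
rewrite big1 => [|d _]; last by rewrite IH !mul0r mulr0.
rewrite add0r big_cons bethe_cons mulr_sumr; apply: eq_bigr => d _.
rewrite IH Brow_cons !ctailK !ccons0 big_ord2 !mxE /Brow.
move: s; apply: ord2P => /=; ring.
Qed.

(** * Vandermonde products with one variable singled out *)

Lemma prod_ltn_ordS N (g : 'I_N.+1 -> 'I_N.+1 -> F) :
  \prod_(p < N.+1) \prod_(q < N.+1 | (p < q)%N) g p q =
  (\prod_j g ord0 (lift ord0 j)) *
  \prod_(p < N) \prod_(q < N | (p < q)%N) g (lift ord0 p) (lift ord0 q).
Proof.
rewrite big_ord_recl; congr (_ * _).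
  by rewrite big_mkcond big_ord_recl /= mul1r.
apply: eq_bigr => p _.
by rewrite big_mkcond big_ord_recl /= mul1r [RHS]big_mkcond.
Qed.

Lemma prod_sign N (i : nat) : (i <= N)%N ->
  \prod_(k < N) (if (k < i)%N then -1 else 1 : F) = (-1) ^+ i.
Proof.
move=> le_iN; rewrite -big_mkcond /= prodr_const; congr (_ ^+ _).
rewrite -sum1_card (big_ord_narrow le_iN) sum1_card card_ord //.
Qed.

Lemma prod_ltnM N (a b : 'I_N -> 'I_N -> F) :
  \prod_(p < N) \prod_(q < N | (p < q)%N) (a p q * b p q) =
  (\prod_(p < N) \prod_(q < N | (p < q)%N) a p q) *
  \prod_(p < N) \prod_(q < N | (p < q)%N) b p q.
Proof. by rewrite -big_split; apply: eq_bigr => p _; rewrite big_split. Qed.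

(** The N - i pairs with mu_i in first place change sign. The factor (-1)^N turns this into (-1)^i,
    the sign of a cofactor. *)
Lemma prod_ltn_lift N (mu : 'I_N.+1 -> F) (i : 'I_N.+1) :
  (-1) ^+ N * \prod_(p < N.+1) \prod_(q < N.+1 | (p < q)%N) (mu p - mu q) =
  (-1) ^+ i * (\prod_(k < N) (mu (lift i k) - mu i)) *
  \prod_(p < N) \prod_(q < N | (p < q)%N) (mu (lift i p) - mu (lift i q)).
Proof.
have mk n (f : 'I_n -> F) : \prod_(p < n) \prod_(q < n | (p < q)%N) (f p - f q) =
  \prod_(p < n) \prod_(q < n) if (p < q)%N then f p - f q else 1.
  by apply: eq_bigr => p _; rewrite big_mkcond.
rewrite !mk (bigD1_ord i) //= (bigD1_ord i) //= ltnn mul1r.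
under [X in _ * (_ * X) = _]eq_bigr => p _ do rewrite (bigD1_ord i) //=.
rewrite big_split /= mulrCA !mulrA; congr (_ * _).
  rewrite -(prod_sign (leq_ord i)).
  have -> : (-1) ^+ N = \prod_(k < N) (-1 : F) by rewrite prodr_const card_ord.
  rewrite -!big_split /=; apply: eq_bigr => k _.
  rewrite /bump; case: (leqP i k) => ik; rewrite ?add1n ?add0n.
    rewrite ltnS ik ltnNge (leqW ik) /=; ring.
  rewrite ltnNge (ltnW ik) /= ik; ring.
apply: eq_bigr => p _; apply: eq_bigr => q _.
by congr (if _ then _ else _); rewrite /= /bump; do 2!case: leqP => ?; lia.
Qed.

(** * The Izergin determinant and the recursion that characterises it *)

Definition izergin_mx N (mu xi : 'I_N -> F) : 'M[F]_N :=
  \matrix_(i, j) ((rho - 1) / ((mu i * rho - xi j) * (mu i - xi j))).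

(** The cofactor of the entry (i, 0); it is independent of the first inhomogeneity. *)
Definition izergin_minor N (mu : 'I_N.+1 -> F) (xi : 'I_N -> F) (i : 'I_N.+1) : F :=
  (-1) ^+ i * \det (izergin_mx (mu \o lift i) xi).

(** Only the first column contains t, so expanding along it clears the denominators in t. The right
    side is polynomial and makes sense at t = mu_i too. *)
Lemma izergin_mx_expand N (mu : 'I_N.+1 -> F) (xi : 'I_N -> F) t :
  (forall i, mu i != t) -> (forall i, mu i * rho != t) ->
  (\prod_i ((mu i - t) * (mu i * rho - t))) * \det (izergin_mx mu (ocons t xi)) =
  \sum_i (rho - 1) * izergin_minor mu xi i *
    \prod_k ((mu (lift i k) - t) * (mu (lift i k) * rho - t)).
Proof.
move=> mut murt; rewrite (expand_det_col _ ord0) mulr_sumr.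
apply: eq_bigr => i _; rewrite (bigD1_ord i) //= !mxE ocons0.
rewrite /cofactor addn0 /izergin_minor.
have -> : row' i (col' ord0 (izergin_mx mu (ocons t xi))) = izergin_mx (mu \o lift i) xi.
  by apply/matrixP => k l; rewrite !mxE oconsS.
field.
by rewrite !subr_eq0 mut murt.
Qed.

Lemma det_izergin_mx_eq0 N (mu : 'I_N.+1 -> F) (xi : 'I_N -> F) q :
  \det (izergin_mx mu (ocons (xi q) xi)) = 0.
Proof.
rewrite -det_tr; apply: (determinant_alternate (neq_lift ord0 q)) => i.
by rewrite !mxE ocons0 oconsS.
Qed.

(** The end of the list is the row acting first, since [bethe] folds from the right. *)
Lemma perm_enum_lift N (i : 'I_N.+1) :
  perm_eq (enum 'I_N.+1) (rcons [seq lift i j | j <- enum 'I_N] i).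
Proof.
rewrite perm_sym perm_rcons; apply: uniq_perm; rewrite ?enum_uniq //.
  rewrite /= (map_inj_uniq lift_inj) enum_uniq andbT.
  by apply/mapP => -[j _ /eqP]; rewrite (negPf (neq_lift _ _)).
move=> j; rewrite inE mem_enum; case: (unliftP i j) => [k ->|->]; rewrite ?eqxx //.
by rewrite map_f ?mem_enum ?orbT.
Qed.

Definition dwpf N (mu xi : 'I_N -> F) : F :=
  bethe xi [seq mu i | i <- enum 'I_N] [ffun=> 1].

Hypotheses (r2 : r ^+ 2 = rho) (rho0 : rho != 0).

Lemma dwpf_frozen N (mu : 'I_N.+1 -> F) (xi : 'I_N -> F) i :
  dwpf mu (ocons (mu i) xi) =
  (rho - 1) * (\prod_j (mu i * rho - xi j)) *
  (\prod_k (mu (lift i k) * rho - mu i)) * dwpf (mu \o lift i) xi.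
Proof.
rewrite /dwpf (bethe_perm r2 rho0 _ (perm_map mu (perm_enum_lift i))) map_rcons.
rewrite -ccons_cst bethe_frozen eqxx mul1r -map_comp; congr (_ * _ * _).
by rewrite big_map -[in RHS]big_enum.
Qed.

Lemma dwpf_polyfun N (mu : 'I_N.+1 -> F) (xi : 'I_N -> F) :
  polyfun N.+1 (fun t => dwpf mu (ocons t xi)).
Proof.
have := bethe_polyfun xi [seq mu i | i <- enum 'I_N.+1] [ffun=> 1].
by rewrite size_map size_enum_ord ffunE /= subn1.
Qed.

(** Stated without dividing by Vandermonde products; the factors mu_m rho - xi_n are the
    normalisation taken out of the R-matrix. The induction starts from the empty lattice. *)
Theorem dwpf_izergin N (mu xi : 'I_N -> F) :
  injective mu -> injective xi ->
  (forall i j, mu i != xi j) -> (forall i j, mu i * rho != xi j) ->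
  dwpf mu xi * \prod_(p < N) \prod_(q < N | (p < q)%N) ((mu p - mu q) * (xi q - xi p)) =
  (\prod_m \prod_n ((mu m - xi n) * (mu m * rho - xi n))) * \det (izergin_mx mu xi).
Proof.
elim: N mu xi => [|N IH] mu xi mu_inj xi_inj muxi murxi.
  rewrite !big_ord0 det_mx00 /dwpf (size0nil (size_enum_ord 0)) ffunE.
  by rewrite (config0 [ffun=> 1] [ffun=> 0]) eqxx.
pose xi' : 'I_N -> F := xi \o lift ord0.
pose P := \prod_(m < N.+1) \prod_(n < N) ((mu m - xi' n) * (mu m * rho - xi' n)).
pose V := (\prod_(p < N.+1) \prod_(q < N.+1 | (p < q)%N) (mu p - mu q)) *
  \prod_(p < N) \prod_(q < N | (p < q)%N) (xi' q - xi' p).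
pose f t := dwpf mu (ocons t xi') * V * \prod_(q < N) (xi' q - t).
pose g t := P * \sum_i (rho - 1) * izergin_minor mu xi' i *
    \prod_k ((mu (lift i k) - t) * (mu (lift i k) * rho - t)).
have gE t : (forall i, mu i != t) -> (forall i, mu i * rho != t) ->
    g t = P * ((\prod_i ((mu i - t) * (mu i * rho - t))) *
               \det (izergin_mx mu (ocons t xi'))).
  by move=> mut murt; rewrite izergin_mx_expand.
have xi'_inj : injective xi' by move=> i j /xi_inj /lift_inj.
have f_mu i : f (mu i) = g (mu i).
  (* In every other summand i is among the remaining rows, so a factor mu_i - t vanishes at t =
     mu_i. *)
  rewrite /g [\sum_i _](bigD1_ord i) //= [\sum_(_ < N) _]big1 => [|k _]; last first.
    case: (unliftP (lift i k) i) => [j ij|/eqP]; last by rewrite (negPf (neq_lift _ _)).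
    by rewrite (bigD1 j) //= -ij subrr mul0r mul0r mulr0.
  have /= IHi := IH (mu \o lift i) xi' (inj_comp mu_inj lift_inj) xi'_inj
    (fun _ _ => muxi _ _) (fun _ _ => murxi _ _).
  rewrite prod_ltnM in IHi.
  have := prod_ltn_lift mu i.
  have E : \prod_(q < N) (xi' q - mu i) = (-1) ^+ N * \prod_(q < N) (mu i - xi' q).
    have -> : (-1) ^+ N = \prod_(q < N) (-1 : F) by rewrite prodr_const card_ord.
    by rewrite -big_split /=; apply: eq_bigr => q _; rewrite mulN1r opprB.
  have PE : P = (\prod_(n < N) (mu i - xi' n)) * (\prod_(n < N) (mu i * rho - xi' n)) *
      \prod_(m < N) \prod_(n < N)
        ((mu (lift i m) - xi' n) * (mu (lift i m) * rho - xi' n)).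
    by rewrite /P (bigD1_ord i) //= big_split.
  have CE : \prod_(k < N) ((mu (lift i k) - mu i) * (mu (lift i k) * rho - mu i)) =
      (\prod_(k < N) (mu (lift i k) - mu i)) * \prod_(k < N) (mu (lift i k) * rho - mu i).
    by rewrite big_split.
  rewrite /f E dwpf_frozen addr0 CE PE /V.
  set Vm := \prod_(p < N.+1) _; set Vi := \prod_(p < N) _ in IHi *.
  set Vx := \prod_(p < N) _ in IHi *; set Pi := \prod_(m < N) _ in IHi *.
  rewrite /izergin_minor; set sN := _ ^+ N; set si := _ ^+ i; move=> VE.
  set D := dwpf _ _ in IHi *; set d := \det _ in IHi *.
  set Pi' := (X in _ = X * d) in IHi *.
  set A := \prod_(n < N) (mu i * rho - _); set B := \prod_(k < N) (_ * rho - mu i).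
  set C := \prod_(n < N) (mu i - _).
  (* The sign (-1)^N from [E] joins the Vandermonde product of mu, and [VE] converts both into the
     cofactor sign. *)
  transitivity ((rho - 1) * A * B * C * (D * Vx) * (sN * Vm)); first by ring.
  rewrite VE; transitivity ((rho - 1) * A * B * C * si * Pi * (D * (Vi * Vx))).
    by ring.
  by rewrite IHi -/Pi'; ring.
have fP : polyfun (N + N).+1 f.
  apply: polyfun_leq (polyfunM (polyfunM (dwpf_polyfun _ _) (polyfunC _))
    (polyfun_prod_ord (m := 1) _)); first by lia.
  by move=> q; apply: (polyfun_affine (a := -1) (b := xi' q)) => t; ring.
have gP : polyfun (N + N).+1 g.
  apply: polyfun_leq (polyfunM (polyfunC _) (polyfun_sum (n := (2 * N).+1) _ _)).
    by lia.
  move=> j _; apply: polyfun_leq (polyfunM (polyfunC _) (polyfun_prod_ord (m := 2) _)).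
    by lia.
  move=> k; apply: (polyfun_leq _ (@polyfunM _ 2 2 _ _ _ _)) => //.
    by apply: (polyfun_affine (a := -1) (b := mu (lift j k))) => t; ring.
  by apply: (polyfun_affine (a := -1) (b := mu (lift j k) * rho)) => t; ring.
(* The N + 1 points mu_i and the N points xi_q number one more than the degree bound 2 N; [muxi]
   keeps the two families apart. *)
have fg : f =1 g.
  apply: (polyfun_eq (rs := codom mu ++ codom xi') fP gP).
  - rewrite cat_uniq; apply/and3P; split; try exact/injectiveP.
    by apply/hasPn => _ /codomP[q ->]; apply/codomP => -[i /esym/eqP]; apply/negP/muxi.
  - by rewrite size_cat !size_codom !card_ord; lia.
  move=> t; rewrite mem_cat => /orP[/codomP[i ->]|/codomP[q ->]]; first exact: f_mu.
  (* At t = xi_q the determinant has two equal columns, and [f] contains the factor xi_q - t. *)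
  rewrite gE => [|i|i]; rewrite ?muxi ?murxi //.
  by rewrite det_izergin_mx_eq0 /f (bigD1 q) //= subrr mul0r !mulr0.
have := fg (xi ord0); rewrite gE // /f ocons_eta prod_ltnM.
rewrite (prod_ltn_ordS (fun p q => xi q - xi p)).
have -> : \prod_m \prod_n ((mu m - xi n) * (mu m * rho - xi n)) =
    (\prod_m ((mu m - xi ord0) * (mu m * rho - xi ord0))) * P.
  by rewrite -big_split; apply: eq_bigr => m _; rewrite big_ord_recl.
by rewrite mulrA (mulrC P) => <-; rewrite /V; ring.
Qed.

End Bethe.

(** * From operators on the tensor product to sums over configurations *)

Section Monodromy.
Variables (F : fieldType) (M : nat).

Definition site_block (A : 'M[F]_(2 * 2)) (s' s : 'I_2) : 'M[F]_2 :=
  \matrix_(a', a) A (mxtens_index (a', s')) (mxtens_index (a, s)).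

Lemma sum_enum_rank (V : nmodType) (T : finType) (f : 'I_#|T| -> V) :
  \sum_k f k = \sum_t f (enum_rank t).
Proof. exact: reindex (onW_bij _ (enum_rank_bij T)). Qed.

Lemma two_siteE (S : finType) (a i : S) (A : 'M[F]_(2 * 2)) (c d : config S) :
  two_site a i A (enum_rank c) (enum_rank d) =
  A (mxtens_index (c a, c i)) (mxtens_index (d a, d i))
    *+ [forall k, (k != a) && (k != i) ==> (c k == d k)].
Proof. by rewrite mxE !enum_rankK. Qed.

(** As each site occurs at most once in [l], the intermediate configurations are forced and only
    auxiliary spins are summed, as in a product of 2 x 2 matrices. *)
Lemma two_site_prodE (A : 'I_M -> 'M[F]_(2 * 2)) (l : seq 'I_M)
    (c d : config (option 'I_M)) : uniq l ->
  (\prod_(i <- rev l) two_site None (Some i) (A i)) (enum_rank c) (enum_rank d) =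
  (\prod_(i <- rev l) site_block (A i) (c (Some i)) (d (Some i))) (c None) (d None)
    *+ [forall i, (i \notin l) ==> (c (Some i) == d (Some i))].
Proof.
elim: l c d => [|i l IH] c d /= => [_|/andP[il Ul]].
  rewrite !big_nil !mxE (inj_eq enum_rank_inj) -mulrnA mulnb.
  congr (_ *+ (nat_of_bool _)); apply/eqP/andP => [->|[/eqP cd0 /forallP cdS]].
    by rewrite eqxx; split=> //; apply/forallP => i; rewrite eqxx.
  by apply/ffunP => -[j|//]; apply/eqP/cdS.
rewrite rev_cons !big_rcons /= mxE sum_enum_rank mxE.
rewrite (partition_big (fun e : config (option 'I_M) => e None) predT) //=.
rewrite -sumrMnl; apply: eq_bigr => b _.
(* The only intermediate configuration with auxiliary spin [b]: site i already has its output value,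
   all other sites still have their input. *)
pose e : config (option 'I_M) := [ffun k => if k is Some j then
  if j == i then c (Some i) else d (Some j) else b].
have eb : e None == b by rewrite ffunE.
rewrite (bigD1 e eb) /= [X in _ + X]big1 => [|e' /andP[/eqP e'b /eqP e'e]]; last first.
  rewrite IH // two_siteE.
  case: (boolP [forall j, (j \notin l) ==> (c (Some j) == e' (Some j))]) =>
    [/forallP e1|_]; last by rewrite mulr0n mul0r.
  case: (boolP [forall k, (k != None) && (k != Some i) ==> (e' k == d k)]) =>
    [/forallP e2|_]; last by rewrite mulr0n mulr0.
  case: e'e; apply/ffunP => -[j|]; rewrite ffunE //.
  case: eqVneq => [->|ji]; first by have := e1 i; rewrite il => /eqP.
  have := e2 (Some j); rewrite /= => /implyP h.
  by apply/eqP/h; apply: contraNneq ji => -[->].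
rewrite addr0 IH // two_siteE mxE.
have -> : [forall k, (k != None) && (k != Some i) ==> (e k == d k)].
  apply/forallP => -[j|] //; rewrite ffunE; apply/implyP => /= ji.
  by case: (eqVneq j i) ji => [->|_ _]; rewrite eqxx.
rewrite mulr1n (eqP eb) [e (Some i)]ffunE eqxx mulrnAl.
congr (_ * _ *+ nat_of_bool _).
  congr (fun_of_matrix _ _ _); apply: eq_big_seq => j; rewrite mem_rev => jl.
  by rewrite ffunE; case: (eqVneq j i) jl il => [->->|].
apply: eq_forallb => j; rewrite inE negb_or ffunE.
by case: (eqVneq j i) => [->|//]; rewrite /= eqxx implybT.
Qed.

Variable inhom : 'I_M -> spectral F.
Variables rho sqrt_rho : F.

Definition Bkernel (l : spectral F) (c d : config 'I_M) : F :=
  site_prod (fun i => site_block (Rmatrix rho sqrt_rho l (inhom i))) c d 0 1.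

Lemma opBE l r s :
  opB rho sqrt_rho inhom l r s = Bkernel l (enum_val r) (enum_val s).
Proof.
rewrite mxE two_site_prodE ?enum_uniq // /Bkernel /site_prod !ffunE.
have -> : [forall i, (i \notin enum 'I_M) ==> (aux_config 0 (enum_val r) (Some i) ==
    aux_config 1 (enum_val s) (Some i))] by apply/forallP => i; rewrite mem_enum.
rewrite mulr1n; congr (fun_of_matrix _ _ _); apply: eq_bigr => i _.
by rewrite !ffunE.
Qed.

Lemma prod_opB_ket0 (I : Type) (l : seq I) (rapid : I -> spectral F) r :
  ((\prod_(m <- l) opB rho sqrt_rho inhom (rapid m)) *m ket0 F M) r 0 =
  foldr (fun m => apply_kernel (Bkernel (rapid m))) (vacuum F M) l (enum_val r).
Proof.
elim: l r => [|m l IH] r.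
  by rewrite big_nil mul1mx !mxE andbT ffunE -(inj_eq enum_val_inj) enum_rankK.
rewrite big_cons -mulmxE -mulmxA mxE /= ffunE sum_enum_rank; apply: eq_bigr => d _.
by rewrite opBE IH !enum_rankK.
Qed.

Lemma ZB_foldr (rapid : 'I_M -> spectral F) :
  ZB rho sqrt_rho inhom rapid =
  foldr (fun m => apply_kernel (Bkernel (rapid m))) (vacuum F M) (enum 'I_M) [ffun=> 1].
Proof.
have braE d : bra1 F M 0 (enum_rank d) = (d == [ffun=> 1])%:R.
  by rewrite !mxE andbT (inj_eq enum_rank_inj).
rewrite /ZB -mulmxA mxE sum_enum_rank (bigD1 [ffun=> 1]) //= [X in _ + X]big1 => [|d d1].
  have -> : \prod_(m < M) opB rho sqrt_rho inhom (rapid m) =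
      \prod_(m <- enum 'I_M) opB rho sqrt_rho inhom (rapid m).
    by rewrite [index_enum _]unlock -enumT.
  by rewrite braE eqxx mul1r addr0 prod_opB_ket0 enum_rankK.
by rewrite braE (negPf d1) mul0r.
Qed.

End Monodromy.

(** * Removing x, z and the square roots by a gauge transformation *)

Section Gauge.
Variables (F : fieldType) (rho r : F).
Local Notation weight := (weight rho r).
Local Notation Brow := (Brow rho r).
Local Notation bethe := (bethe rho r).

Definition magnon_number N (c : config 'I_N) : nat := \sum_i c i.

Lemma magnon_number_cons N (c : config 'I_N.+1) :
  magnon_number c = (c ord0 + magnon_number (ctail c))%N.
Proof.
rewrite /magnon_number big_ord_recl; congr (_ + _)%N.
by apply: eq_bigr => i _; rewrite ffunE.
Qed.

Lemma weight_neq0 mu xi (s' s a' a : 'I_2) :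
  weight mu xi s' s a' a != 0 -> (a' + s' = a + s)%N.
Proof. by rewrite mxE; case: (eqVneq (a' + s')%N) => [//|_] /=; rewrite eqxx. Qed.

Lemma site_prod_neq0 N (xi : 'I_N -> F) mu (c d : config 'I_N) (a' a : 'I_2) :
  site_prod (fun i => weight mu (xi i)) c d a' a != 0 ->
  (a' + magnon_number c = a + magnon_number d)%N.
Proof.
elim: N xi c d a' a => [|N IH] xi c d a' a.
  rewrite site_prod0 mxE /magnon_number !big_ord0 !addn0.
  by case: (eqVneq a' a) => [->//|_]; rewrite eqxx.
rewrite site_prodS mxE => n0.
have [b] : exists b, site_prod ((fun i => weight mu (xi i)) \o lift ord0)
    (ctail c) (ctail d) a' b * weight mu (xi ord0) (c ord0) (d ord0) b a != 0.
  apply/existsP; apply: contraNT n0; rewrite negb_exists => /forallP h.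
  by rewrite big1 // => b _; apply/eqP; have := h b; rewrite negbK.
rewrite mulf_eq0 negb_or => /andP[/IH e /weight_neq0 e'].
rewrite !magnon_number_cons; lia.
Qed.

(** Each row takes in e_2 and emits e_1 on the auxiliary line, so it adds one e_2 to the sites. *)
Lemma bethe_neq0 N (xi : 'I_N -> F) mus (c : config 'I_N) :
  bethe xi mus c != 0 -> magnon_number c = size mus.
Proof.
elim: mus c => [|mu mus IH] c.
  rewrite ffunE; case: (eqVneq c) => [->|]; last by rewrite eqxx.
  by rewrite /magnon_number big1 // => i _; rewrite ffunE.
rewrite [bethe _ _ _]ffunE => n0.
have [d] : exists d, Brow xi mu c d * bethe xi mus d != 0.
  apply/existsP; apply: contraNT n0; rewrite negb_exists => /forallP h.
  by rewrite big1 // => b _; apply/eqP; have := h b; rewrite negbK.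
by rewrite mulf_eq0 negb_or => /andP[/site_prod_neq0 /= e /IH <-].
Qed.

(* The factor (a' + a) / 2 in the exponent of z_j becomes a function of the site
   configurations: by conservation of the number of e_2, the auxiliary spin
   reaching site j is the incoming one plus the change over the sites i < j. *)
Definition site_gauge N (z sxi sz : 'I_N -> F) (i : 'I_N) : F :=
  sxi i / (sz i * \prod_(j < N | (i < j)%N) z j).

Definition config_gauge N (z sxi sz : 'I_N -> F) (c : config 'I_N) : F :=
  \prod_i site_gauge z sxi sz i ^+ c i.

Lemma site_gaugeS N (z sxi sz : 'I_N.+1 -> F) i :
  site_gauge z sxi sz (lift ord0 i) =
  site_gauge (z \o lift ord0) (sxi \o lift ord0) (sz \o lift ord0) i.
Proof. by rewrite /site_gauge big_mkcond big_ord_recl /= mul1r -big_mkcond. Qed.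

Lemma config_gaugeS N (z sxi sz : 'I_N.+1 -> F) c :
  config_gauge z sxi sz c =
  (sxi ord0 / (sz ord0 * \prod_i z (lift ord0 i))) ^+ c ord0 *
  config_gauge (z \o lift ord0) (sxi \o lift ord0) (sz \o lift ord0) (ctail c).
Proof.
rewrite /config_gauge big_ord_recl; congr (_ ^+ _ * _).
  by rewrite /site_gauge big_mkcond big_ord_recl /= mul1r.
by apply: eq_bigr => i _; rewrite site_gaugeS ffunE.
Qed.

Lemma site_block_gauge (mu x smu sx xi z sxi sz : F) (s' s a' a : 'I_2) :
  sx ^+ 2 = x -> sz ^+ 2 = z -> smu ^+ 2 = mu -> sxi ^+ 2 = xi ->
  x != 0 -> z != 0 -> mu != 0 -> xi != 0 -> mu * rho != xi ->
  site_block (Rmatrix rho r (Spectral mu x smu sx) (Spectral xi z sxi sz)) s' s a' a =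
  weight mu xi s' s a' a *
  (sx^-1 ^+ (s' + s) * sz ^+ (a' + a) * (smu ^+ a / smu ^+ a') *
   (sxi ^+ s' / sxi ^+ s) / (mu * rho - xi)).
Proof.
move=> <- <- <- <-; rewrite !expf_eq0 /= => sx0 sz0 smu0 sxi0; rewrite -subr_eq0 => d0.
rewrite !mxE; move: s' s a' a; do 4!(apply: ord2P) => /=; rewrite ?mul0r //.
(* The value of 1 in ['I_2] unfolds to [1 %% 2] and is folded back before [field]. *)
all: rewrite ?[(1 %% 2)%N]/(1%N) ?addn0 ?add0n ?expr0 ?expr1.
all: by field; rewrite ?sx0 ?sz0 ?smu0 ?sxi0 ?d0 ?oner_eq0.
Qed.

Section Sites.
Variables (N : nat) (xi z sxi sz : 'I_N -> F).
Hypotheses (sxiE : forall i, sxi i ^+ 2 = xi i) (szE : forall i, sz i ^+ 2 = z i).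
Hypotheses (xi0 : forall i, xi i != 0) (z0 : forall i, z i != 0).

Lemma site_gauge_neq0 i : site_gauge z sxi sz i != 0.
Proof.
rewrite mulf_neq0 ?invr_eq0 ?mulf_neq0 //; last by apply/prodf_neq0.
  by have := xi0 i; rewrite -sxiE expf_eq0.
by have := z0 i; rewrite -szE expf_eq0.
Qed.

Lemma config_gauge_neq0 c : config_gauge z sxi sz c != 0.
Proof. by apply/prodf_neq0 => i _; rewrite expf_neq0 ?site_gauge_neq0. Qed.

End Sites.

(** The algebra at the first site: conservation b + c0 = a + d0 trades the power of [Z] (the product
    of the remaining z_j) at the inner spin b for one at the incoming spin a and the site spins. *)
Lemma gauge_step (W w u v m sa s t Z gc gd D e : F) (c0 d0 b a : 'I_2) :
  (b + c0 = a + d0)%N -> m != 0 -> sa != 0 -> s != 0 -> t != 0 -> Z != 0 ->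
  gc != 0 -> gd != 0 -> D != 0 -> e != 0 ->
  W * (u * (m ^+ b / sa) * Z ^+ b * (gc / gd) / D) *
  (w * (v ^+ (c0 + d0) * s ^+ (b + a) * (m ^+ a / m ^+ b) * (t ^+ c0 / t ^+ d0) / e)) =
  W * w * (v ^+ (c0 + d0) * u * (m ^+ a / sa) * (s ^+ 2 * Z) ^+ a *
    ((t / (s * Z)) ^+ c0 * gc / ((t / (s * Z)) ^+ d0 * gd)) / (e * D)).
Proof.
move: c0 d0 b a; (do 4!(apply: ord2P)); move=> // _ m0 sa0 s0 t0 Z0 gc0 gd0 D0 e0 /=;
  rewrite ?[(1 %% 2)%N]/(1%N) ?addn0 ?add0n ?expr0 ?expr1;
  by field; rewrite ?m0 ?sa0 ?s0 ?t0 ?Z0 ?gc0 ?gd0 ?D0 ?e0 ?oner_eq0.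
Qed.

Lemma site_prod_gauge (mu x smu sx : F) N (xi z sxi sz : 'I_N -> F)
    (c d : config 'I_N) (a' a : 'I_2) :
  sx ^+ 2 = x -> smu ^+ 2 = mu -> x != 0 -> mu != 0 ->
  (forall i, sxi i ^+ 2 = xi i) -> (forall i, sz i ^+ 2 = z i) ->
  (forall i, xi i != 0) -> (forall i, z i != 0) -> (forall i, mu * rho != xi i) ->
  site_prod (fun i => site_block (Rmatrix rho r (Spectral mu x smu sx)
    (Spectral (xi i) (z i) (sxi i) (sz i)))) c d a' a =
  site_prod (fun i => weight mu (xi i)) c d a' a *
  (sx^-1 ^+ (magnon_number c + magnon_number d) * (smu ^+ a / smu ^+ a') *
   (\prod_i z i) ^+ a * (config_gauge z sxi sz c / config_gauge z sxi sz d) /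
   \prod_i (mu * rho - xi i)).
Proof.
move=> sxE smuE x0 mu0; have smu0 : smu != 0 by move: mu0; rewrite -smuE expf_eq0.
elim: N xi z sxi sz c d a' a => [|N IH] xi z sxi sz c d a' a sxiE szE xi0 z0 murxi.
  rewrite !site_prod0 mxE /magnon_number /config_gauge !big_ord0.
  case: (eqVneq a' a) => [->|]; last by rewrite mul0r.
  by rewrite divff ?expf_neq0 // addn0 expr0 expr1n !divr1 !mulr1.
have cg0 e : config_gauge (z \o lift ord0) (sxi \o lift ord0) (sz \o lift ord0) e != 0.
  by apply: (config_gauge_neq0 (xi := xi \o lift ord0)) => i /=; auto.
have sz0 : sz ord0 != 0 by have := z0 ord0; rewrite -szE expf_eq0.
have sxi0 : sxi ord0 != 0 by have := xi0 ord0; rewrite -sxiE expf_eq0.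
have Z0 : \prod_i z (lift ord0 i) != 0 by apply/prodf_neq0.
have d0 : mu * rho - xi ord0 != 0 by rewrite subr_eq0.
have D0 : \prod_i (mu * rho - xi (lift ord0 i)) != 0.
  by apply/prodf_neq0 => i _; rewrite subr_eq0.
rewrite !site_prodS !mxE mulr_suml; apply: eq_bigr => b _.
rewrite (IH (xi \o lift ord0) (z \o lift ord0) (sxi \o lift ord0) (sz \o lift ord0));
  try by move=> i /=; auto.
rewrite site_block_gauge //.
(* A vanishing weight kills both sides; otherwise conservation at this vertex is available. *)
have [->|/weight_neq0 e] := eqVneq (weight mu (xi ord0) (c ord0) (d ord0) b a) 0.
  by rewrite !(mul0r, mulr0).
rewrite !magnon_number_cons !config_gaugeS !big_ord_recl -szE.
rewrite [(_ + _ + (_ + _))%N]addnACA [_ ^+ (_ + _ + _)]exprD.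
by apply: gauge_step; rewrite ?expf_neq0.
Qed.

Section BetheGauge.
Variables (M : nat) (mu x smu sx : 'I_M -> F) (N : nat) (xi z sxi sz : 'I_N -> F).
Hypotheses (smuE : forall m, smu m ^+ 2 = mu m) (sxE : forall m, sx m ^+ 2 = x m).
Hypotheses (sxiE : forall i, sxi i ^+ 2 = xi i) (szE : forall i, sz i ^+ 2 = z i).
Hypotheses (mu0 : forall m, mu m != 0) (x0 : forall m, x m != 0).
Hypotheses (xi0 : forall i, xi i != 0) (z0 : forall i, z i != 0).
Hypothesis murxi : forall m i, mu m * rho != xi i.

(** Here [k] counts the e_2 before the row, so 2 k + 1 adds the counts before and after it. The
    incoming auxiliary e_2 yields [smu m] and the product of the z_i. *)
Definition row_gauge (m : 'I_M) (k : nat) : F :=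
  (sx m)^-1 ^+ (2 * k + 1) * smu m * (\prod_i z i) / \prod_i (mu m * rho - xi i).

Fixpoint rows_gauge (l : seq 'I_M) : F :=
  if l is m :: l' then row_gauge m (size l') * rows_gauge l' else 1.

(** The factors [config_gauge] cancel between consecutive rows, leaving that of the final
    configuration, since the vacuum has gauge 1. *)
Lemma bethe_gauge l c :
  foldr (fun m => apply_kernel (Bkernel
      (fun i => Spectral (xi i) (z i) (sxi i) (sz i)) rho r
      (Spectral (mu m) (x m) (smu m) (sx m)))) (vacuum F N) l c =
  bethe xi (map mu l) c * (rows_gauge l * config_gauge z sxi sz c).
Proof.
elim: l c => [|m l IH] c.
  rewrite /= ffunE; case: (eqVneq c) => [->|]; last by rewrite !mul0r.
  rewrite mulr1n /config_gauge big1 => [|i _]; first by rewrite !mulr1.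
  by rewrite ffunE expr0.
rewrite /= !ffunE mulr_suml; apply: eq_bigr => d _; rewrite IH.
rewrite /Bkernel site_prod_gauge //.
have smu0 : smu m != 0 by have := mu0 m; rewrite -smuE expf_eq0.
have cd0 := config_gauge_neq0 sxiE szE xi0 z0 d.
have D0 : \prod_i (mu m * rho - xi i) != 0 by apply/prodf_neq0 => i _; rewrite subr_eq0.
rewrite -/(Brow xi (mu m) c d).
(* Nonzero terms have determined numbers of e_2 in [c] and [d], which fixes the power of sqrt x. *)
have [->|/site_prod_neq0 /= ec] := eqVneq (Brow xi (mu m) c d) 0; first by rewrite !mul0r.
have [->|/bethe_neq0 ed] := eqVneq (bethe xi (map mu l) d) 0.
  by rewrite !(mul0r, mulr0).
rewrite size_map in ed.
have -> : (magnon_number c + magnon_number d = 2 * size l + 1)%N by move: ec ed; lia.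
rewrite /row_gauge expr0 ?[(1 %% 2)%N]/(1%N) !expr1.
by field; rewrite cd0 D0 ?oner_eq0.
Qed.

Lemma rows_gaugeE (m0 : 'I_M) (l : seq 'I_M) :
  rows_gauge l = \prod_(0 <= k < size l) row_gauge (nth m0 l k) (size l - k.+1).
Proof.
elim: l => [|m l IH]; first by rewrite big_nil.
by rewrite big_nat_recl //= subn1 IH.
Qed.

Lemma rows_gauge_enum : (0 < M)%N ->
  rows_gauge (enum 'I_M) = \prod_(k < M) row_gauge k (M - k.+1).
Proof.
move=> M0; rewrite (rows_gaugeE (Ordinal M0)) size_enum_ord big_mkord.
by apply: eq_bigr => k _; rewrite nth_ord_enum.
Qed.

End BetheGauge.

Lemma prod_gauge_tail N (z : 'I_N -> F) :
  \prod_(i < N) \prod_(j < N | (i < j)%N) z j = \prod_(j < N) z j ^+ j.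
Proof.
rewrite (exchange_big_dep predT) //=; apply: eq_bigr => j _.
rewrite prodr_const; congr (_ ^+ _).
rewrite -[RHS](card_ord j) -!sum1_card (big_ord_narrow (ltnW (ltn_ord j))).
by rewrite !sum1_card.
Qed.

(** The N rows give z_i^N; the all-e_2 gauge divides by sqrt z_i and by z_i once for each of the i
    sites before i, counted from 0. *)
Lemma config_gauge_ones N (z sxi sz : 'I_N -> F) :
  (forall i, sz i ^+ 2 = z i) -> (forall i, z i != 0) ->
  (\prod_i z i) ^+ N * config_gauge z sxi sz [ffun=> 1] =
  \prod_i (sxi i * sz i ^+ (2 * (N - i) - 1)).
Proof.
move=> szE z0.
have -> : config_gauge z sxi sz [ffun=> 1] = \prod_i site_gauge z sxi sz i.
  by apply: eq_bigr => i _; rewrite ffunE expr1.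
rewrite big_split /= prodfV big_split /= prod_gauge_tail -prodrXl mulrCA big_split /=.
congr (_ * _); rewrite -big_split /= -prodfV -big_split; apply: eq_bigr => i _ /=.
have sz0 : sz i != 0 by have := z0 i; rewrite -szE expf_eq0.
rewrite -szE -!exprM -exprS; apply: (mulIf (expf_neq0 (2 * i).+1 sz0)).
rewrite divfK ?expf_neq0 // -exprD; congr (_ ^+ _).
by move: (ltn_ord i); lia.
Qed.

End Gauge.

(** * Combining the gauge factors with the determinant formula *)

Theorem mainTheorem7 (R : realType) (rho sqrt_rho : R[i])
  (hrho0 : rho != 0) (hrho1 : rho != 1) (hsqrt_rho : sqrt_rho ^+ 2 = rho)
  (M : nat) (hM : (1 <= M)%N)
  (mu x sqrt_mu sqrt_x : 'I_M -> R[i])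
  (xi z sqrt_xi sqrt_z : 'I_M -> R[i])
  (hsqrt_mu : forall m, sqrt_mu m ^+ 2 = mu m)
  (hsqrt_x : forall m, sqrt_x m ^+ 2 = x m)
  (hsqrt_xi : forall m, sqrt_xi m ^+ 2 = xi m)
  (hsqrt_z : forall m, sqrt_z m ^+ 2 = z m)
  (hmu0 : forall m, mu m != 0) (hx0 : forall m, x m != 0)
  (hxi0 : forall m, xi m != 0) (hz0 : forall m, z m != 0)
  (hmu : injective mu) (hxi : injective xi)
  (hmuxi : forall i j, mu i != xi j)
  (hmurho : forall i j, mu i * rho != xi j)
  (hxirho : forall i j, i != j -> xi i * rho != xi j) :
  ZB rho sqrt_rho
    (fun i => Spectral (xi i) (z i) (sqrt_xi i) (sqrt_z i))
    (fun m => Spectral (mu m) (x m) (sqrt_mu m) (sqrt_x m))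
  = (\prod_(k < M) (sqrt_z k / sqrt_x k) ^+ (2 * (M - k) - 1))
    * ((\prod_(k < M) (sqrt_mu k * sqrt_xi k))
         * (\prod_(m < M) \prod_(n < M) (mu m - xi n))
       / \prod_(p < M) \prod_(q < M | (p < q)%N)
           ((mu p - mu q) * (xi q - xi p)))
    * \det (\matrix_(i < M, j < M)
              ((rho - 1) / ((mu i * rho - xi j) * (mu i - xi j)))).
Proof.
have hV : \prod_(p < M) \prod_(q < M | (p < q)%N)
    ((mu p - mu q) * (xi q - xi p)) != 0.
  apply/prodf_neq0 => p _; apply/prodf_neq0 => q lt_pq.
  have pq : p != q by apply: contraTneq lt_pq => ->; rewrite ltnn.
  by rewrite mulf_neq0 // subr_eq0 ?(inj_eq hmu) ?(inj_eq hxi) // eq_sym.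
have hD : \prod_(m < M) \prod_(n < M) (mu m * rho - xi n) != 0.
  by apply/prodf_neq0 => m _; apply/prodf_neq0 => n _; rewrite subr_eq0.
(* Row k, counted from 0, acts after M - k - 1 others, and 2 (M - k - 1) + 1 = 2 (M - k) - 1. *)
have rowsE : rows_gauge rho mu sqrt_mu sqrt_x xi z (enum 'I_M) =
    (\prod_(k < M) (sqrt_x k)^-1 ^+ (2 * (M - k) - 1)) * (\prod_(k < M) sqrt_mu k) *
    (\prod_(i < M) z i) ^+ M / \prod_(m < M) \prod_(n < M) (mu m * rho - xi n).
  have -> : (\prod_i z i) ^+ M = \prod_(k < M) \prod_i z i.
    by rewrite prodr_const card_ord.
  rewrite rows_gauge_enum // -prodfV -!big_split.
  apply: eq_bigr => k _; rewrite /row_gauge /=; congr (_ ^+ _ * _ * _ / _).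
  by move: (ltn_ord k); lia.
have dwpfE := dwpf_izergin hsqrt_rho hrho0 hmu hxi hmuxi hmurho.
rewrite ZB_foldr (bethe_gauge sqrt_rho hsqrt_mu hsqrt_x hsqrt_xi hsqrt_z) //.
rewrite -/(dwpf rho sqrt_rho mu xi) rowsE.
have := config_gauge_ones sqrt_xi hsqrt_z hz0.
set Z := (\prod_i z i) ^+ M; set cg := config_gauge _ _ _ _ => cgE.
have prodM2 (f g : 'I_M -> 'I_M -> R[i]) :
    \prod_m \prod_n (f m n * g m n) =
    (\prod_m \prod_n f m n) * \prod_m \prod_n g m n.
  by rewrite -big_split; apply: eq_bigr => m _; rewrite big_split.
rewrite prodM2 -/(izergin_mx rho mu xi) in dwpfE *.
have -> : \prod_(k < M) (sqrt_z k / sqrt_x k) ^+ (2 * (M - k) - 1) =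
    (\prod_(k < M) sqrt_z k ^+ (2 * (M - k) - 1)) *
    \prod_(k < M) (sqrt_x k)^-1 ^+ (2 * (M - k) - 1).
  by rewrite -big_split; apply: eq_bigr => k _; rewrite exprMn.
rewrite [\prod_(k < M) (sqrt_mu k * _)]big_split /=.
rewrite big_split /= in cgE.
apply: (mulIf hV).
move: hV hD dwpfE cgE.
set V := \prod_(p < M) _; set D := \prod_(m < M) \prod_(n < M) (_ * _ - _).
set A := \prod_m _; set S := \prod_(k < M) _^-1 ^+ _; set U := \prod_(k < M) sqrt_mu k.
set T := \prod_(i < M) _ ^+ _; set X := \prod_(i < M) sqrt_xi i.
set d := \det _; set B := dwpf _ _ _ _ => hV hD dwpfE cgE.
(* The row denominators [D] cancel the factors mu_m rho - xi_n in [dwpfE]. *)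
transitivity ((B * V) * (S * U / D * (Z * cg))); first by ring.
by rewrite dwpfE cgE; field; rewrite hV hD.
Qed.
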